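(* Let $(A,\cdot,\Phi=\{\partial_1,\partial_2\})$ be a $\Psi=\{\eth_1,\eth_2\}$-admissible commutative differential algebra and $(A,[\ ,\ ],\cdot)$ be the induced Poisson algebra of $(A,\cdot,\Phi)$. Suppose that $\eth_2(\partial_1(a))\cdot b=\eth_1(\partial_2(a))\cdot b$ for all $a,b\in A$. Then every solution of the $\Psi$-admissible associative Yang--Baxter equation in $(A,\cdot,\Phi)$ is a solution of the Poisson Yang--Baxter equation in the Poisson algebra $(A,[\ ,\ ],\cdot)$.
   Context: All vector spaces and algebras are finite-dimensional over a field $\mathbb F$ of characteristic $0$; ''algebra'' means associative algebra, not necessarily unital. Commutative differential algebra $(A,\cdot,\{\partial_1,\partial_2\})$: commutative algebra with commuting derivations. Its induced Poisson algebra is $(A,[\ ,\ ],\cdot)$ with $[a,b]=\partial_1(a)\cdot\partial_2(b)-\partial_2(a)\cdot\partial_1(b)$. It is $\Psi=\{\eth_1,\eth_2\}$-admissible, for commuting linear maps $\eth_1,\eth_2\colon A\to A$, if for $k=1,2$ and all $a,b$: $\eth_k(a)\cdot b=a\cdot\partial_k(b)+\eth_k(a\cdot b)$ and $a\cdot\eth_k(b)=\partial_k(a)\cdot b+\eth_k(a\cdot b)$. For $r=\sum_ia_i\otimes b_i\in A\otimes A$: $r_{12}r_{13}=\sum_{i,j}a_i\cdot a_j\otimes b_i\otimes b_j$, $r_{13}r_{23}=\sum_{i,j}a_i\otimes a_j\otimes b_i\cdot b_j$, $r_{23}r_{12}=\sum_{i,j}a_j\otimes a_i\cdot b_j\otimes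 b_i$, and $[r_{12},r_{13}]=\sum_{i,j}[a_i,a_j]\otimes b_i\otimes b_j$, $[r_{13},r_{23}]=\sum_{i,j}a_i\otimes a_j\otimes[b_i,b_j]$, $[r_{12},r_{23}]=\sum_{i,j}a_i\otimes[b_i,a_j]\otimes b_j$. $r$ is a solution of the $\Psi$-admissible associative Yang--Baxter equation if $r_{12}r_{13}+r_{13}r_{23}-r_{23}r_{12}=0$ and, for $k=1,2$, $(\partial_k\otimes\mathrm{id}-\mathrm{id}\otimes\eth_k)(r)=0$ and $(\eth_k\otimes\mathrm{id}-\mathrm{id}\otimes\partial_k)(r)=0$. $r$ is a solution of the Poisson Yang--Baxter equation (PYBE) in $(A,[\ ,\ ],\cdot)$ if both $r_{12}r_{13}+r_{13}r_{23}-r_{23}r_{12}=0$ and $[r_{12},r_{13}]+[r_{13},r_{23}]+[r_{12},r_{23}]=0$. *)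

(* Defs.v *)
From HB Require Import structures.
From mathcomp Require Import all_boot all_algebra.
From mathcomp Require Import ring.

Set Implicit Arguments.
Unset Strict Implicit.
Unset Printing Implicit Defensive.

Import GRing.Theory.
Local Open Scope ring_scope.

Reserved Notation "u ⊗ v" (at level 40, left associativity).

(* A tensor is stored as its matrix of coordinates in the products of the
   vectors of the bases [vbasis fullv]; [tlift_pure], [tlift_unique] and
   [tensor_span] below give the universal property, so nothing depends on the
   choice of bases. *)
Section Tensor.
Variable F : fieldType.

Definition tensor (U V : vectType F) : Type :=
  'M[F]_(\dim (fullv : {vspace U}), \dim (fullv : {vspace V})).

HB.instance Definition _ (U V : vectType F) := Vector.on (tensor U V).

Definition pure (U V : vectType F) (u : U) (v : V) : tensor U V :=
  \matrix_(i, j) (coord (vbasis fullv) i u * coord (vbasis fullv) j v).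

Local Notation "u ⊗ v" := (pure u v).

(* The linear map on the tensor product induced by [f], when [f] is bilinear. *)
Definition tlift (U V : vectType F) (W : lmodType F) (f : U -> V -> W)
    (t : tensor U V) : W :=
  \sum_i \sum_j t i j *: f (vbasis fullv)`_i (vbasis fullv)`_j.

Definition tmap (U V U' V' : vectType F) (f : U -> U') (g : V -> V')
    (t : tensor U V) : tensor U' V' :=
  tlift (fun u v => f u ⊗ g v) t.

Lemma pure_is_bilinear (U V : vectType F) :
  bilinear_for *:%R *:%R (@pure U V).
Proof.
split=> [v k u u'|u k v v']; apply/matrixP=> i j; rewrite !mxE linearP /=; ring.
Qed.

HB.instance Definition _ (U V : vectType F) :=
  bilinear_isBilinear.Build F U V (tensor U V) *:%R *:%R (@pure U V)
    (@pure_is_bilinear U V).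

Lemma tlift_is_linear (U V : vectType F) (W : lmodType F) (f : U -> V -> W) :
  linear (tlift f).
Proof.
move=> k s t; rewrite /tlift scaler_sumr -big_split; apply: eq_bigr => i _.
rewrite scaler_sumr -big_split; apply: eq_bigr => j _ /=.
by rewrite !mxE scalerDl scalerA.
Qed.

HB.instance Definition _ (U V : vectType F) (W : lmodType F)
    (f : U -> V -> W) :=
  GRing.isLinear.Build F (tensor U V) W *:%R (tlift f) (tlift_is_linear f).

Lemma tlift_pure (U V : vectType F) (W : lmodType F)
    (f : {bilinear U -> V -> W}) u v :
  tlift f (u ⊗ v) = f u v.
Proof.
rewrite {2}(coord_vbasis (memvf u)) {2}(coord_vbasis (memvf v)) linear_sumlz.
apply: eq_bigr => i _; rewrite linearZl_LR linear_sumr scaler_sumr.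
by apply: eq_bigr => j _; rewrite mxE linearZr_LR scalerA.
Qed.

Lemma pure_basis (U V : vectType F)
    (i : 'I_(\dim (fullv : {vspace U}))) (j : 'I_(\dim (fullv : {vspace V}))) :
  ((vbasis fullv)`_i : U) ⊗ ((vbasis fullv)`_j : V) = delta_mx i j.
Proof.
apply/matrixP=> k l; rewrite !mxE !coord_free ?(basis_free (vbasisP _)) //.
by rewrite -natrM mulnb [k == i]eq_sym [l == j]eq_sym.
Qed.

Lemma tensor_span (U V : vectType F) (t : tensor U V) :
  t = \sum_i \sum_j (t i j *: (vbasis fullv)`_i) ⊗ (vbasis fullv)`_j.
Proof.
rewrite {1}[t](matrix_sum_delta t).
apply: eq_bigr => i _; apply: eq_bigr => j _.
by rewrite linearZl_LR /= pure_basis.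
Qed.

Lemma tlift_unique (U V : vectType F) (W : lmodType F) (f : U -> V -> W)
    (h : {linear tensor U V -> W}) :
  (forall u v, h (u ⊗ v) = f u v) -> h =1 tlift f.
Proof.
move=> hE t; rewrite [in LHS](tensor_span t) linear_sum.
apply: eq_bigr => i _; rewrite linear_sum.
by apply: eq_bigr => j _; rewrite linearZl_LR linearZ hE.
Qed.

Lemma tmap_pure (U V U' V' : vectType F) (f : {linear U -> U'})
    (g : {linear V -> V'}) u v : tmap f g (u ⊗ v) = f u ⊗ g v.
Proof.
have fg_bil : bilinear_for *:%R *:%R (fun u v => f u ⊗ g v).
  by split=> [v' k x y|u' k x y] /=; rewrite linearP ?linearPl ?linearPr.
pose b := bilinear_isBilinear.Build _ _ _ _ _ _ _ fg_bil.
pose fg : {bilinear U -> V -> tensor U' V'} := HB.pack (fun u v => f u ⊗ g v) b.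
exact: (tlift_pure fg).
Qed.

End Tensor.

Notation "u ⊗ v" := (pure u v) : ring_scope.

(* Elements of A ⊗ A ⊗ A built from two copies of r and a product [op]; the
   lemmas [r12_r13_sum] etc. give the usual formulas for an arbitrary
   decomposition of r into pure tensors. *)
Section TensorLegs.
Variables (F : fieldType) (A : vectType F).
Implicit Types (op : A -> A -> A) (r : tensor A A).

Definition r12_r13 op r : tensor (tensor A A) A :=
  tlift (fun a b => tlift (fun a' b' => op a a' ⊗ b ⊗ b') r) r.

Definition r13_r23 op r : tensor (tensor A A) A :=
  tlift (fun a b => tlift (fun a' b' => a ⊗ a' ⊗ op b b') r) r.

Definition r23_r12 op r : tensor (tensor A A) A :=
  tlift (fun a b => tlift (fun a' b' => a' ⊗ op a b' ⊗ b) r) r.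

Definition r12_r23 op r : tensor (tensor A A) A :=
  tlift (fun a b => tlift (fun a' b' => a ⊗ op b a' ⊗ b') r) r.

Lemma tlift_sum (W : lmodType F) (f : A -> A -> W) n (a b : 'I_n -> A) :
  bilinear_for *:%R *:%R f ->
  tlift f (\sum_i a i ⊗ b i) = \sum_i f (a i) (b i).
Proof.
move=> fP; pose c := bilinear_isBilinear.Build _ _ _ _ _ _ _ fP.
pose g : {bilinear A -> A -> W} := HB.pack f c.
by rewrite linear_sum; apply: eq_bigr => i _; apply: (tlift_pure g).
Qed.

Lemma tlift2_sum (W : lmodType F) (f : A -> A -> A -> A -> W) n
    (a b : 'I_n -> A) :
    (forall x y, bilinear_for *:%R *:%R (f x y)) ->
    (forall x y, bilinear_for *:%R *:%R (fun x' y' => f x' y' x y)) ->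
  let r := \sum_i a i ⊗ b i in
  tlift (fun x y => tlift (f x y) r) r
    = \sum_i \sum_j f (a i) (b i) (a j) (b j).
Proof.
move=> f2 f1 r; rewrite [LHS]tlift_sum => [|].
  by apply: eq_bigr => i _; rewrite tlift_sum.
split=> [y k x x'|x k y y'] /=; rewrite !tlift_sum // scaler_sumr -big_split;
  apply: eq_bigr => i _ /=.
  by have [/(_ y) ->] := f1 (a i) (b i).
by have [_ /(_ x) ->] := f1 (a i) (b i).
Qed.

Variables (op : {bilinear A -> A -> A}) (n : nat) (a b : 'I_n -> A).
Let r := \sum_i a i ⊗ b i.

Let linE := (linearPl, linearPr, linearP).

Lemma r12_r13_sum :
  r12_r13 op r = \sum_i \sum_j op (a i) (a j) ⊗ b i ⊗ b j.
Proof.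
apply: (@tlift2_sum _ (fun x y x' y' => op x x' ⊗ y ⊗ y')) => x y;
  by split=> u k v w /=; rewrite !linE.
Qed.

Lemma r13_r23_sum :
  r13_r23 op r = \sum_i \sum_j a i ⊗ a j ⊗ op (b i) (b j).
Proof.
apply: (@tlift2_sum _ (fun x y x' y' => x ⊗ x' ⊗ op y y')) => x y;
  by split=> u k v w /=; rewrite !linE.
Qed.

Lemma r23_r12_sum :
  r23_r12 op r = \sum_i \sum_j a j ⊗ op (a i) (b j) ⊗ b i.
Proof.
apply: (@tlift2_sum _ (fun x y x' y' => x' ⊗ op x y' ⊗ y)) => x y;
  by split=> u k v w /=; rewrite !linE.
Qed.

Lemma r12_r23_sum :
  r12_r23 op r = \sum_i \sum_j a i ⊗ op (b i) (a j) ⊗ b j.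
Proof.
apply: (@tlift2_sum _ (fun x y x' y' => x ⊗ op y x' ⊗ y')) => x y;
  by split=> u k v w /=; rewrite !linE.
Qed.

End TensorLegs.

Section Algebras.
Variables (F : fieldType) (A : vectType F).

Definition is_derivation (mul : A -> A -> A) (d : A -> A) : Prop :=
  forall a b, d (mul a b) = mul (d a) b + mul a (d b).

(* Algebras are not assumed unital, so [A] is a bare vector space. *)
Record comDiffAlg := ComDiffAlg {
  cmul : {bilinear A -> A -> A};
  cmulA : associative cmul;
  cmulC : commutative cmul;
  der1 : 'End(A);
  der2 : 'End(A);
  der1P : is_derivation cmul der1;
  der2P : is_derivation cmul der2;
  derC : forall a, der1 (der2 a) = der2 (der1 a)
}.

Record poissonAlg := PoissonAlg {
  pmul : {bilinear A -> A -> A};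
  pbracket : {bilinear A -> A -> A};
  pmulA : associative pmul;
  pmulC : commutative pmul;
  pbracketxx : forall a, pbracket a a = 0;
  pbracket_jacobi : forall a b c,
    pbracket a (pbracket b c) + pbracket b (pbracket c a)
      + pbracket c (pbracket a b) = 0;
  pbracket_leibniz : forall a b c,
    pbracket a (pmul b c) = pmul (pbracket a b) c + pmul b (pbracket a c)
}.

Definition induced_bracket (D : comDiffAlg) (a b : A) : A :=
  cmul D (der1 D a) (der2 D b) - cmul D (der2 D a) (der1 D b).

Lemma induced_bracket_is_bilinear D :
  bilinear_for *:%R *:%R (induced_bracket D).
Proof.
by split=> [b k x y|a k x y] /=; rewrite /induced_bracket !(linearP (der1 D))
  !(linearP (der2 D)) ?linearPl ?linearPr /= scalerBr opprD addrACA.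
Qed.

HB.instance Definition _ D :=
  bilinear_isBilinear.Build F A A A *:%R *:%R (induced_bracket D)
    (induced_bracket_is_bilinear D).

Lemma induced_bracketxx D a : induced_bracket D a a = 0.
Proof. by rewrite /induced_bracket cmulC subrr. Qed.

Lemma induced_bracket_jacobi D a b c (br := induced_bracket D) :
  br a (br b c) + br b (br c a) + br c (br a b) = 0.
Proof.
pose m x y z := cmul D x (cmul D y z).
have m_rot x y z : m x y z = m z x y.
  by rewrite /m cmulA [LHS]cmulC.
have brE x y z : br x (br y z) =
    m (der1 D x) (der1 D (der2 D y)) (der2 D z)
    + m (der1 D x) (der1 D y) (der2 D (der2 D z))
    - m (der1 D x) (der2 D (der2 D y)) (der1 D z)
    - m (der1 D x) (der2 D y) (der1 D (der2 D z))
    - m (der2 D x) (der1 D (der1 D y)) (der2 D z)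
    - m (der2 D x) (der1 D y) (der1 D (der2 D z))
    + m (der2 D x) (der1 D (der2 D y)) (der1 D z)
    + m (der2 D x) (der2 D y) (der1 D (der1 D z)).
  rewrite /br /induced_bracket /m !linearB /= !der1P !der2P -!derC.
  by rewrite !(linearBr, linearDr) /= !opprD !opprK !addrA.
rewrite !brE.
rewrite ![m (der1 D c) _ _]m_rot ![m (der2 D c) _ _]m_rot.
rewrite ![m (der1 D b) _ _]m_rot ![m (der2 D b) _ _]m_rot.
rewrite ![m (der1 D (der1 D b)) _ _]m_rot ![m (der1 D (der2 D b)) _ _]m_rot.
rewrite ![m (der2 D (der2 D b)) _ _]m_rot.
have coord0 (v : A) : (forall i, coord (vbasis fullv) i v = 0) -> v = 0.
  by move=> v0; rewrite (coord_vbasis (memvf v)) big1 // => i _; rewrite v0 scale0r.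
apply: coord0 => i; rewrite !(linearD, linearN) /=.
ring.
Qed.

Lemma induced_bracket_leibniz D a b c :
  induced_bracket D a (cmul D b c)
    = cmul D (induced_bracket D a b) c + cmul D b (induced_bracket D a c).
Proof.
rewrite /induced_bracket der1P der2P !linearDr linearNr linearBl /= !cmulA.
rewrite [cmul D b (der1 D a)]cmulC [cmul D b (der2 D a)]cmulC.
rewrite opprD -!addrA; congr (_ + _).
by rewrite addrCA.
Qed.

Definition induced_poisson (D : comDiffAlg) : poissonAlg :=
  @PoissonAlg (cmul D) (induced_bracket D) (@cmulA D) (@cmulC D)
    (induced_bracketxx D) (induced_bracket_jacobi D) (induced_bracket_leibniz D).

Definition admissible_for (mul : A -> A -> A) (d e : A -> A) : Prop :=
  forall a b, mul (e a) b = mul a (d b) + e (mul a b)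
           /\ mul a (e b) = mul (d a) b + e (mul a b).

Definition admissible (D : comDiffAlg) (e1 e2 : 'End(A)) : Prop :=
  [/\ forall a, e1 (e2 a) = e2 (e1 a),
      admissible_for (cmul D) (der1 D) e1
    & admissible_for (cmul D) (der2 D) e2].

Definition AYBE (mul : A -> A -> A) (r : tensor A A) : Prop :=
  r12_r13 mul r + r13_r23 mul r - r23_r12 mul r = 0.

Definition CYBE (br : A -> A -> A) (r : tensor A A) : Prop :=
  r12_r13 br r + r13_r23 br r + r12_r23 br r = 0.

Definition tensor_compat (d e : A -> A) (r : tensor A A) : Prop :=
  tmap d id r - tmap id e r = 0 /\ tmap e id r - tmap id d r = 0.

Definition admissible_AYBE (D : comDiffAlg) (e1 e2 : 'End(A))
    (r : tensor A A) : Prop :=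
  [/\ AYBE (cmul D) r, tensor_compat (der1 D) e1 r
    & tensor_compat (der2 D) e2 r].

Definition PYBE (P : poissonAlg) (r : tensor A A) : Prop :=
  AYBE (pmul P) r /\ CYBE (pbracket P) r.

End Algebras.

(* Main.v *)
Require Import Defs.
From HB Require Import structures.
From mathcomp Require Import all_boot all_algebra.

(** The induced bracket is a skew combination of products of derivatives, so
    each of the three terms of the classical Yang-Baxter equation comes from the
    corresponding term of the associative one.  On the triple tensor product
    take the operator X = 1 ⊗ e1 ⊗ e2 - 1 ⊗ e2 ⊗ e1 ([wedge23 e1 e2]).  Then

      X (r12 r13) = [r12, r13],  X (r13 r23) = [r13, r23],
      X (r23 r12) = - [r12, r23],

    and applying X to the associative equation gives the classical one.

    The three identities ([wedge23_r12_r13], [wedge23_r13_r23],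
    [wedge23_r23_r12]) rest on the compatibility conditions on r, which allow
    the k-th derivation on one leg of r to be traded for ek on the other
    ([sum_compat]).  In the first identity e1 and e2 act on the second legs of
    two different copies of r, and trading both of them suffices.  In the other
    two, one of them acts on a product; trading the other one produces, up to sign,

      e2 (x · d1 y) - e1 (x · d2 y),

    with dk the k-th derivation, and [skew_admissible] identifies this
    expression with [x, y]. *)

Set Implicit Arguments.
Unset Strict Implicit.
Unset Printing Implicit Defensive.

Import GRing.Theory.
Local Open Scope ring_scope.

Lemma tmap_is_linear (F : fieldType) (U V U' V' : vectType F)
    (f : U -> U') (g : V -> V') : linear (tmap f g).
Proof. exact: tlift_is_linear. Qed.

HB.instance Definition _ (F : fieldType) (U V U' V' : vectType F)
    (f : U -> U') (g : V -> V') :=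
  GRing.isLinear.Build F (tensor U V) (tensor U' V') *:%R (tmap f g)
    (tmap_is_linear f g).

(** The explicit formulas for the products of legs of a tensor apply to sums of
    pure tensors over a single index, whereas the expansion in a basis is a
    double sum; grouping the latter by its second factor gives such a sum. *)
Lemma tensor_sum_pure (F : fieldType) (U V : vectType F) (t : tensor U V) :
  exists n (a : 'I_n -> U) (b : 'I_n -> V), t = \sum_i a i ⊗ b i.
Proof.
exists (\dim (fullv : {vspace V})).
exists (fun j => \sum_i t i j *: (vbasis fullv)`_i).
exists (fun j => (vbasis fullv)`_j).
rewrite {1}(tensor_span t) exchange_big.
by apply: eq_bigr => j _; rewrite linear_sumlz.
Qed.

Section Wedge23.
Variables (F : fieldType) (A : vectType F).

Definition wedge23 (e e' : A -> A) (t : tensor (tensor A A) A) :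
    tensor (tensor A A) A :=
  tmap (tmap id e) e' t - tmap (tmap id e') e t.

Lemma wedge23_pure (e e' : 'End(A)) x y z :
  wedge23 e e' (x ⊗ y ⊗ z) = x ⊗ e y ⊗ e' z - x ⊗ e' y ⊗ e z.
Proof.
have id_pure (f : 'End(A)) : tmap id f (x ⊗ y) = x ⊗ f y.
  exact: (tmap_pure idfun f).
by rewrite /wedge23 !tmap_pure /= !id_pure.
Qed.

Lemma wedge23_is_linear e e' : linear (wedge23 e e').
Proof. by move=> k s t; rewrite /wedge23 !linearP /= scalerDr addrACA. Qed.

HB.instance Definition _ e e' :=
  GRing.isLinear.Build F (tensor (tensor A A) A) (tensor (tensor A A) A) *:%R
    (wedge23 e e') (wedge23_is_linear e e').

End Wedge23.

(** Admissibility turns the left side into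
    x · e2 (d1 y) - d2 x · d1 y - x · e1 (d2 y) + d1 x · d2 y,
    whose first and third terms cancel by the relation between e2 d1 and
    e1 d2. *)
Lemma skew_admissible (F : fieldType) (A : vectType F) (D : comDiffAlg A)
    (e1 e2 : 'End(A)) : admissible D e1 e2 ->
    (forall a b, cmul D (e2 (der1 D a)) b = cmul D (e1 (der2 D a)) b) ->
  forall x y, e2 (cmul D x (der1 D y)) - e1 (cmul D x (der2 D y))
    = induced_bracket D x y.
Proof.
move=> [_ adm1 adm2] e21 x y.
have eE (d e : 'End(A)) : admissible_for (cmul D) d e ->
    forall u v, e (cmul D u v) = cmul D u (e v) - cmul D (d u) v.
  by move=> adm u v; have [_ ->] := adm u v; rewrite addrAC subrr add0r.
rewrite (eE _ _ adm1) (eE _ _ adm2) [cmul D x (e2 _)]cmulC e21.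
by rewrite [cmul D x (e1 _)]cmulC opprB addrC addrA subrK.
Qed.

Section CompatibleTensor.
Variables (F : fieldType) (A : vectType F) (D : comDiffAlg A).
Variables (e1 e2 : 'End(A)) (n : nat) (a b : 'I_n -> A).
Let r : tensor A A := \sum_i a i ⊗ b i.

(** The compatibility of r, an identity between tensors with two legs, holds
    inside any expression that is bilinear in the legs of r; it is used below
    with f landing in the triple tensor product, the other copy of r being held
    fixed. *)
Lemma sum_compat (d e : 'End(A)) (W : lmodType F) (f : A -> A -> W) :
    tmap d id r - tmap id e r = 0 -> bilinear_for *:%R *:%R f ->
  \sum_i f (d (a i)) (b i) = \sum_i f (a i) (e (b i)).
Proof.
move=> /subr0_eq + f_bil.
have -> : tmap d id r = \sum_i d (a i) ⊗ b i.
  by rewrite linear_sum; apply: eq_bigr => i _; apply: (tmap_pure d idfun).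
have -> : tmap id e r = \sum_i a i ⊗ e (b i).
  by rewrite linear_sum; apply: eq_bigr => i _; apply: (tmap_pure idfun e).
by move=> /(congr1 (tlift f)); rewrite !tlift_sum.
Qed.

Local Ltac bilin := by split=> ? ? ? ? /=; rewrite !(linearPl, linearPr, linearP).

Hypotheses (r_compat1 : tensor_compat (der1 D) e1 r)
  (r_compat2 : tensor_compat (der2 D) e2 r).

(** Here e1 and e2 act on the second legs of the two copies of r, so that each
    can be traded for a derivation acting on one factor of the product. *)
Lemma wedge23_r12_r13 :
  wedge23 e1 e2 (r12_r13 (cmul D) r) = r12_r13 (induced_bracket D) r.
Proof.
have [de1 _] := r_compat1; have [de2 _] := r_compat2.
have trade (d d' e e' : 'End(A)) :
    tmap d id r - tmap id e r = 0 -> tmap d' id r - tmap id e' r = 0 ->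
  \sum_i \sum_j cmul D (a i) (a j) ⊗ e (b i) ⊗ e' (b j) =
  \sum_i \sum_j cmul D (d (a i)) (d' (a j)) ⊗ b i ⊗ b j.
  move=> de de'.
  under [RHS]eq_bigr => i _.
    rewrite (sum_compat (f := fun x y => cmul D _ x ⊗ b i ⊗ y) de'); first over.
    bilin.
  rewrite exchange_big [RHS]exchange_big; apply: eq_bigr => j _; symmetry.
  apply: (sum_compat (f := fun x y => cmul D x (a j) ⊗ y ⊗ e' (b j)) de).
  bilin.
rewrite !r12_r13_sum /= linear_sum.
transitivity (\sum_i \sum_j cmul D (a i) (a j) ⊗ e1 (b i) ⊗ e2 (b j)
              - \sum_i \sum_j cmul D (a i) (a j) ⊗ e2 (b i) ⊗ e1 (b j)).
  rewrite -sumrB; apply: eq_bigr => i _; rewrite linear_sum -sumrB.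
  by apply: eq_bigr => j _; rewrite /= wedge23_pure.
rewrite (trade _ _ _ _ de1 de2) (trade _ _ _ _ de2 de1) -sumrB.
apply: eq_bigr => i _; rewrite -sumrB; apply: eq_bigr => j _.
by rewrite /induced_bracket !linearBl.
Qed.

(** In the next two identities one of e1, e2 acts on a product and the other on
    an untouched leg of r.  Trading the latter puts a derivation inside the
    product; up to sign, this gives the left side of the following relation. *)
Hypothesis skew_adm : forall x y,
  e2 (cmul D x (der1 D y)) - e1 (cmul D x (der2 D y)) = induced_bracket D x y.

Lemma wedge23_r13_r23 :
  wedge23 e1 e2 (r13_r23 (cmul D) r) = r13_r23 (induced_bracket D) r.
Proof.
have [_ ed1] := r_compat1; have [_ ed2] := r_compat2.
rewrite !r13_r23_sum /= linear_sum; apply: eq_bigr => i _.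
rewrite linear_sum /=; under eq_bigr do rewrite wedge23_pure.
rewrite sumrB.
rewrite (sum_compat (f := fun x y => a i ⊗ x ⊗ e2 (cmul D (b i) y)) ed1);
  last bilin.
rewrite (sum_compat (f := fun x y => a i ⊗ x ⊗ e1 (cmul D (b i) y)) ed2);
  last bilin.
by rewrite -sumrB; apply: eq_bigr => j _; rewrite -linearBr skew_adm.
Qed.

Lemma wedge23_r23_r12 :
  wedge23 e1 e2 (r23_r12 (cmul D) r) = - r12_r23 (induced_bracket D) r.
Proof.
have [de1 _] := r_compat1; have [de2 _] := r_compat2.
rewrite r23_r12_sum r12_r23_sum /= exchange_big linear_sum -sumrN.
apply: eq_bigr => j _.
rewrite linear_sum -sumrN /=; under eq_bigr do rewrite wedge23_pure.
rewrite sumrB.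
rewrite -(sum_compat (f := fun x y => a j ⊗ e1 (cmul D x (b j)) ⊗ y) de2);
  last bilin.
rewrite -(sum_compat (f := fun x y => a j ⊗ e2 (cmul D x (b j)) ⊗ y) de1);
  last bilin.
rewrite -sumrB; apply: eq_bigr => i _.
(* The derivations are on the first factor of the products: commuting the
   factors produces [b j, a i] with the opposite sign. *)
by rewrite ![cmul D _ (b j)]cmulC -skew_adm linearBr linearBl opprB.
Qed.

End CompatibleTensor.

Theorem proposition5p31 (F : fieldType) (charF0 : [pchar F] =i pred0)
    (A : vectType F) (D : comDiffAlg A) (e1 e2 : 'End(A))
    (admD : admissible D e1 e2)
    (e21 : forall a b : A, cmul D (e2 (der1 D a)) b = cmul D (e1 (der2 D a)) b)
    (r : tensor A A) :
  admissible_AYBE D e1 e2 r -> PYBE (induced_poisson D) r.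
Proof.
move=> [aybe compat1 compat2]; split; first exact: aybe.
have skew_adm := skew_admissible admD e21.
have [n [a [b rE]]] := tensor_sum_pure r.
rewrite rE in aybe compat1 compat2 *.
have := congr1 (wedge23 e1 e2) aybe.
rewrite linear0 linearB linearD /= (wedge23_r12_r13 compat1 compat2).
rewrite (wedge23_r13_r23 compat1 compat2 skew_adm).
by rewrite (wedge23_r23_r12 compat1 compat2 skew_adm) opprK.
Qed.
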